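(* Let $D$ be any digraph of order $n$. Then $\gamma_{iso}(D)=n$ if and only if for every vertex $u$ of $D$, $d^+(u)=0$ or $d^-(u)=0$.
   Context: Digraphs $D=(V,A)$ are finite, without loops or multiple arcs (pairs of opposite arcs allowed). $N^+(v)=\{w: vw\in A\}$, $N^-(v)=\{w: wv\in A\}$, $d^\pm(v)=|N^\pm(v)|$. $S\subseteq V$ is out-dominating if every $v\in V\setminus S$ has an in-neighbor in $S$. $S$ is an in-secure out-dominating set (ISODS) if $S$ is out-dominating and for every $v\in V\setminus S$ there is $u\in N^+(v)\cap S$ such that $(S\setminus\{u\})\cup\{v\}$ is out-dominating; $\gamma_{iso}(D)$ is the minimum size of an ISODS. *)

(* Defs.v *)
From mathcomp Require Import all_boot.

Set Implicit Arguments.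
Unset Strict Implicit.
Unset Printing Implicit Defensive.

(* A digraph on the finite vertex type V is given by its arc relation D, where
   D v w means that vw is an arc. A relation excludes multiple arcs and allows
   opposite ones; looplessness is the hypothesis [irreflexive D]. *)
Section Digraph.

Variables (V : finType) (D : rel V).
Implicit Types (v : V) (S : {set V}).

Definition out_nbhd v : {set V} := [set w | D v w].
Definition in_nbhd v : {set V} := [set w | D w v].

Definition outdeg v : nat := #|out_nbhd v|.
Definition indeg v : nat := #|in_nbhd v|.

Definition out_dominating S : bool :=
  [forall v in ~: S, exists u in S, u \in in_nbhd v].

Definition isods S : bool :=
  out_dominating S &&
  [forall v in ~: S, exists u in out_nbhd v :&: S,
     out_dominating ((S :\ u) :|: [set v])].

Lemma isodsT : isods [set: V].
Proof.
by apply/andP; split; apply/forall_inP => v; rewrite setCT inE.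
Qed.

(* The default [set: V] is itself an ISODS, so this is the true minimum. *)
Definition gamma_iso : nat := #|[arg min_(S < [set: V] | isods S) #|S|]|.

Lemma gamma_iso_witness : exists2 S, isods S & #|S| = gamma_iso.
Proof.
rewrite /gamma_iso; case: arg_minnP => [|S SP _]; first exact: isodsT.
by exists S.
Qed.

Lemma gamma_iso_min S : isods S -> gamma_iso <= #|S|.
Proof.
rewrite /gamma_iso; case: arg_minnP => [|S0 _ minS0]; first exact: isodsT.
exact: minS0.
Qed.

End Digraph.

(* Main.v *)
Require Import Defs.
From mathcomp Require Import all_boot.

(* A vertex outside an ISODS has an in-neighbor and an out-neighbor in it, so
   only the whole vertex set can be an ISODS when every vertex is a source or a
   sink. Conversely, if v has both an in-neighbor and an out-neighbor u, then
   V \ {v} is an ISODS: swapping v and u gives V \ {u}, in which v dominates u. *)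

(** Only [v] is left to dominate, so a single arc into it suffices. *)
Lemma out_dominating_setC1 (V : finType) (D : rel V) (w v : V) :
  w != v -> D w v -> out_dominating D (~: [set v]).
Proof.
move=> wv Dwv; apply/forall_inP => x; rewrite setCK => /set1P ->.
by apply/exists_inP; exists w; rewrite !inE.
Qed.

Lemma isods_setC1 (V : finType) (D : rel V) (w v u : V) :
  irreflexive D -> D w v -> D v u -> isods D (~: [set v]).
Proof.
move=> D_irr Dwv Dvu.
(* Without loops, [w] and [u] differ from [v] and so lie in [~: [set v]]. *)
have neq x y : D x y -> x != y by apply: contraTneq => ->; rewrite D_irr.
apply/andP; split; first exact: out_dominating_setC1 (neq _ _ Dwv) Dwv.
apply/forall_inP => x; rewrite setCK => /set1P ->.
apply/exists_inP; exists u; first by rewrite !inE Dvu eq_sym neq.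
suff -> : (~: [set v] :\ u) :|: [set v] = ~: [set u].
  exact: out_dominating_setC1 (neq _ _ Dvu) Dvu.
apply/setP => y; rewrite !inE; case: (eqVneq y v) => [->|_].
  by rewrite orbT neq.
by rewrite andbT orbF.
Qed.

(** Domination supplies the in-neighbor; the out-neighbor is the vertex of [S] that [v] replaces. *)
Lemma isods_notin_deg (V : finType) (D : rel V) (S : {set V}) (v : V) :
  isods D S -> v \notin S -> 0 < outdeg D v /\ 0 < indeg D v.
Proof.
rewrite -in_setC => /andP[/forall_inP dom /forall_inP sec] vS; split.
  have /exists_inP[u /setIP[uv _] _] := sec v vS.
  by apply/card_gt0P; exists u.
by have /exists_inP[u _ uv] := dom v vS; apply/card_gt0P; exists u.
Qed.

Theorem theorem5p6 (n : nat) (V : finType) (D : rel V)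
    (D_loopless : irreflexive D) (V_order : #|V| = n) :
  gamma_iso D = n <-> (forall u : V, outdeg D u = 0 \/ indeg D u = 0).
Proof.
split=> [gamma_n v | deg0].
  have [->|] := posnP (outdeg D v); first by left.
  have [->|] := posnP (indeg D v); first by right.
  case/card_gt0P => w; rewrite inE => Dwv /card_gt0P[u]; rewrite inE => Dvu.
  have := gamma_iso_min (isods_setC1 _ _ _ _ _ D_loopless Dwv Dvu).
  (* Splitting [v] off [#|V|] exposes a successor, so [#|V| <= #|V|.-1] becomes an absurd
     [m < m]. *)
  by rewrite gamma_n -V_order cardsC1 (cardD1 v) inE ltnn.
have [S isoS <-] := gamma_iso_witness D.
suff -> : S = [set: V] by rewrite cardsT.
apply/setP => v; rewrite inE; apply/negPn/negP => vS.
have [] := isods_notin_deg _ _ _ _ isoS vS.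
by case: (deg0 v) => ->.
Qed.
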